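(* Let $\alpha\in(0,1)$, $t\ge0$, $\Delta\in[0,1/2]$ with $t>0$ or $\Delta<1/2$. Let $\hat\theta_1,\dots,\hat\theta_{B^*}$ in the Unimodal HulC procedure be independent, continuously distributed, computed from approximately equal-sized disjoint parts of the data, and suppose there are $r_{n,\alpha}>0$, $\delta_{n,\alpha}\ge0$ and a continuous random variable $W$, unimodal at $0$, with $\Delta=|\tfrac12-\mathbb{P}(W\le0)|$, such that for every $j$, \[ \sup_{u\in\mathbb{R}}\big|\mathbb{P}(r_{n,\alpha}(\hat\theta_j-\theta_0)\le u)-\mathbb{P}(W\le u)\big|\le\delta_{n,\alpha}. \] Then $\mathbb{P}(\theta_0\notin\widehat{\mathrm{CI}}^{\mathrm{mode}}_\alpha)\le\alpha\big(1-10B_{\alpha,t,\Delta}(1+t)\delta_{n,\alpha}\big)_+^{-1}$ (interpreted as $+\infty$ when the denominator is $0$).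
   Context: For integer $B\ge0$ and $\Delta\in[0,1/2]$, $P(B;\Delta):=(\tfrac12-\Delta)^B+(\tfrac12+\Delta)^B$. $Q(B;t,\Delta):=P(B;\Delta)(1+t)^{-B+1}$ and $B_{\alpha,t,\Delta}$ is the smallest integer $B\ge1$ with $Q(B;t,\Delta)\le\alpha$. A random variable $W$ is unimodal at $0$ if its distribution function is convex on $(-\infty,0]$ and concave on $[0,\infty)$. Unimodal HulC procedure: with $B=B_{\alpha,t,\Delta}$, set $\eta_{\alpha,t}:=\frac{Q(B-1;t,\Delta)-\alpha}{Q(B-1;t,\Delta)-Q(B;t,\Delta)}$; draw $U\sim\mathrm{Unif}[0,1]$ independent of the data and set $B^*=B$ if $U\le\eta_{\alpha,t}$, else $B^*=B-1$; split the data randomly into $B^*$ disjoint parts of approximately equal size, compute $\hat\theta_j$ (an estimate of $\theta_0\in\mathbb{R}$) on part $j$, let $\hat\theta_{\max}=\max_j\hat\theta_j$, $\hat\theta_{\min}=\min_j\hat\theta_j$, and output $\widehat{\mathrm{CI}}^{\mathrm{mode}}_\alpha:=[\hat\theta_{\min}-t(\hat\theta_{\max}-\hat\theta_{\min}),\ \hat\theta_{\max}+t(\hat\theta_{\max}-\hat\theta_{\min})]$. *)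

(* Defs.v *)
From HB Require Import structures.
From mathcomp Require Import all_boot all_order all_algebra.
From mathcomp Require Import all_classical all_reals all_analysis.
Set Implicit Arguments. Unset Strict Implicit. Unset Printing Implicit Defensive.
Import Order.TTheory GRing.Theory Num.Theory.
Local Open Scope classical_set_scope.
Local Open Scope ring_scope.

Section HulC.
Variable R : realType.

Definition Pfun (B : nat) (Delta : R) : R :=
  (2^-1 - Delta) ^+ B + (2^-1 + Delta) ^+ B.

Definition Qfun (B : nat) (t Delta : R) : R :=
  Pfun B Delta * (1 + t) ^ (1 - (B%:Z))%R.

Definition is_B_alpha (alpha t Delta : R) (B : nat) : Prop :=
  (1 <= B)%N /\ Qfun B t Delta <= alpha /\
  forall B' : nat, (1 <= B')%N -> Qfun B' t Delta <= alpha -> (B <= B')%N.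

Definition eta_alpha (alpha t Delta : R) (B : nat) : R :=
  (Qfun B.-1 t Delta - alpha) / (Qfun B.-1 t Delta - Qfun B t Delta).

Definition convex_on (D : set R) (f : R -> R) : Prop :=
  forall x y l, D x -> D y -> 0 <= l <= 1 ->
    f (l * x + (1 - l) * y) <= l * f x + (1 - l) * f y.

Definition concave_on (D : set R) (f : R -> R) : Prop :=
  convex_on D (fun x => - f x).

Definition distr_fun d (T : measurableType d) (P : probability T R) (X : T -> R)
  (u : R) : R := fine (P [set w | X w <= u]).

Definition unimodal_at0 d (T : measurableType d) (P : probability T R)
  (X : T -> R) : Prop :=
  convex_on [set x | x <= 0] (distr_fun P X) /\ concave_on [set x | 0 <= x] (distr_fun P X).

Definition continuous_rv d (T : measurableType d) (P : probability T R)
  (X : T -> R) : Prop :=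
  forall x : R, P [set w | X w = x] = 0%E.

Definition mutually_independent d (T : measurableType d) (P : probability T R)
  (n : nat) (X : nat -> T -> R) : Prop :=
  forall A : nat -> set R, (forall i, measurable (A i)) ->
    P (\bigcap_(i in [set i | (i < n)%N]) (X i @^-1` A i)) =
    (\prod_(i < n) P (X i @^-1` A i))%E.

(* the estimators of the run with k splits: th k j for j < k *)
Definition th_max (th : nat -> nat -> R) (k : nat) : R :=
  \big[Num.max/th k 0%N]_(j < k) th k j.
Definition th_min (th : nat -> nat -> R) (k : nat) : R :=
  \big[Num.min/th k 0%N]_(j < k) th k j.

Definition in_CI (t theta0 : R) (th : nat -> nat -> R) (k : nat) : Prop :=
  th_min th k - t * (th_max th k - th_min th k) <= theta0 <=
  th_max th k + t * (th_max th k - th_min th k).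

Definition hulc_bound (alpha t delta : R) (B : nat) : \bar R :=
  let D := Num.max 0 (1 - 10 * B%:R * (1 + t) * delta) in
  if 0 < D then (alpha / D)%:E else +oo%E.

End HulC.

(* Main.v *)
Require Import Defs.
From HB Require Import structures.
From mathcomp Require Import all_boot all_order all_algebra.
From mathcomp Require Import all_classical all_reals all_analysis.
From mathcomp Require Import measurable_realfun.
From mathcomp Require Import ring lra.
Import Order.TTheory GRing.Theory Num.Theory.
Import numFieldNormedType.Exports.
Local Open Scope classical_set_scope.
Local Open Scope ring_scope.

(** With [X j = r (th j - theta0)], the interval misses [theta0] iff
    [t X j < (1 + t) X i] for all [i], [j], or the same holds for [- X]. On the
    first event all [X j] are positive; conditioning on the largest one, located
    at [y], forces the others into the interval from [t / (1 + t) y] to [y], whose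
    probability under the law of [W] is at most [(F y - F 0) / (1 + t)] by
    concavity of the distribution function [F] on the half-line. Instead of
    integrating over [y], the half-line is cut into [m] cells of equal [W]-mass;
    independence is then only used for rectangles, the sum over the cells
    telescopes, and replacing the laws of the [X j] by that of [W] costs a multiple
    of [delta] through summation by parts. Adding the two sides gives
    [Q / (1 - 10 k (1 + t) delta)] for [k] splits, and [eta] is the weight for
    which the mixture of [Q B] and [Q (B - 1)] is [alpha]. *)

(** * Elementary inequalities for powers and finite sums *)

(** Convexity of the power function: its graph lies above the tangent at [u]. In the induction, [v]
    times the previous inequality leaves the remainder [k.+1 u^k (v - u)^2]. *)
Lemma exprS_tangent (R : realFieldType) (u v : R) (k : nat) : 0 <= u -> 0 <= v ->
  k.+1%:R * u ^+ k * (v - u) <= v ^+ k.+1 - u ^+ k.+1.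
Proof.
move=> u0 v0; elim: k => [|k IH]; first by rewrite !expr1 expr0; lra.
have -> : v ^+ k.+2 - u ^+ k.+2
        = v * (v ^+ k.+1 - u ^+ k.+1) + u ^+ k.+1 * (v - u).
  by rewrite !exprS; ring.
have := ler_wpM2l v0 IH.
have : 0 <= k.+1%:R * u ^+ k * (v - u) ^+ 2.
  by rewrite mulr_ge0 ?sqr_ge0 // mulr_ge0 ?exprn_ge0.
by rewrite -[k.+2%:R]natr1 !(exprS u) expr2; lra.
Qed.

(** A left Riemann sum with step [c] for the derivative of [x^(k+1)]; the tangent inequalities at
    the left endpoints telescope. *)
Lemma sum_expr_arith_le (R : realFieldType) (b c : R) (k m : nat) : 0 <= b -> 0 <= c ->
  k.+1%:R * c * \sum_(l < m) (c * l%:R + b) ^+ k <= (c * m%:R + b) ^+ k.+1.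
Proof.
move=> b0 c0; elim: m => [|m IH].
  by rewrite big_ord0 mulr0 exprn_ge0 // mulr0 add0r.
have cm0 n : 0 <= c * n%:R + b by rewrite addr_ge0 ?mulr_ge0 ?ler0n.
have cE : c * m.+1%:R + b - (c * m%:R + b) = c by rewrite -natr1; ring.
have := @exprS_tangent R _ _ k (cm0 m) (cm0 m.+1).
by rewrite cE big_ord_recr /= mulrDr; lra.
Qed.

(** Summation by parts moves the differences from [d] to [H], whose increments are nonnegative, so
    each [d l] can be replaced by its upper bound. *)
Lemma abel_sum_le (R : realFieldType) (d H : nat -> R) (delta : R) (m : nat) :
  (forall l, (l <= m)%N -> d l <= delta) ->
  0 <= H 0%N -> (forall l, H l <= H l.+1) ->
  \sum_(l < m.+1) (d l - d l.+1) * H l <= (delta - d m.+1) * H m.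
Proof.
move=> dle H0 Hnd; elim: m dle => [|m IH] dle.
  by rewrite big_ord_recr big_ord0 /= add0r ler_wpM2r // lerD2r dle.
rewrite big_ord_recr /=.
have := IH (fun l lm => dle l (leqW lm)).
have : 0 <= (delta - d m.+1) * (H m.+1 - H m).
  by rewrite mulr_ge0 // subr_ge0 ?dle.
by lra.
Qed.

(** Chebyshev's sum inequality: the pairs [a, b] and [a^k, b^k] are ordered the same way. *)
Lemma sumX_le_sumXS (R : realFieldType) (a b : R) (k : nat) : 0 <= a -> 0 <= b ->
  (a + b) * (a ^+ k + b ^+ k) <= 2 * (a ^+ k.+1 + b ^+ k.+1).
Proof.
move=> a0 b0.
have : 0 <= (a - b) * (a ^+ k - b ^+ k).
  have [ab|/ltW ba] := leP a b.
    by apply: mulr_le0; rewrite subr_le0 // lerXn2r.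
  by apply: mulr_ge0; rewrite subr_ge0 // lerXn2r.
by rewrite !exprS; lra.
Qed.

(* With [K = k.+1 (1 + t) delta]: passing from [x / (1 + t)] to [a] costs a factor
   [1 / (1 - 8 K)], the term in [delta] a factor [1 + 2 K]. *)
Lemma two_sided_bound_le (R : realFieldType) (t delta x y a b : R) (k : nat) :
  0 <= t -> 0 <= delta -> 0 <= x -> 0 <= y -> x + y = 1 ->
  a = x / (1 + t) + 4 * delta -> b = y / (1 + t) + 4 * delta ->
  ((1 + t) * (a ^+ k.+1 + b ^+ k.+1) + k.+1%:R * delta * (a ^+ k + b ^+ k))
    * (1 - 10 * k.+1%:R * (1 + t) * delta)
  <= (x ^+ k.+1 + y ^+ k.+1) / (1 + t) ^+ k.
Proof.
move=> t0 d0 x0 y0 xy1 aE bE.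
have t1 : 0 < 1 + t by lra.
have q0 z : 0 <= z -> 0 <= z / (1 + t) by move=> ?; rewrite divr_ge0 // ltW.
have a0 : 0 <= a by rewrite aE addr_ge0 ?q0 //; lra.
have b0 : 0 <= b by rewrite bE addr_ge0 ?q0 //; lra.
set n := k.+1%:R; have n0 : 0 <= n by rewrite ler0n.
have rhsE z : z ^+ k.+1 / (1 + t) ^+ k = (1 + t) * (z / (1 + t)) ^+ k.+1.
  rewrite expr_div_n [(1 + t) ^+ k.+1]exprS; field.
  by rewrite expf_neq0 // gt_eqF.
have tangent z : 0 <= z -> (z / (1 + t) + 4 * delta) ^+ k.+1
    - 4 * delta * n * (z / (1 + t) + 4 * delta) ^+ k <= (z / (1 + t)) ^+ k.+1.
  move=> z0; have c0 : 0 <= z / (1 + t) + 4 * delta by rewrite addr_ge0 ?q0 //; lra.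
  by have := @exprS_tangent R _ _ k c0 (q0 _ z0); rewrite -/n; lra.
(* Since [x + y = 1], the sum [a + b] is at least [1 / (1 + t)]; Chebyshev's inequality then trades
   the power [k] for [k.+1] at the price [2 (1 + t)]. *)
have Sk : a ^+ k + b ^+ k <= 2 * (1 + t) * (a ^+ k.+1 + b ^+ k.+1).
  have s0 : 0 <= a ^+ k + b ^+ k by rewrite addr_ge0 ?exprn_ge0.
  have : (1 + t)^-1 <= a + b.
    have -> : a + b = (x + y) / (1 + t) + 8 * delta by rewrite aE bE; ring.
    by rewrite xy1 div1r lerDl; lra.
  move=> /(ler_wpM2r s0) /le_trans /(_ (@sumX_le_sumXS R a b k a0 b0)).
  by rewrite ler_pdivrMl //; lra.
have S0 : 0 <= a ^+ k + b ^+ k by rewrite addr_ge0 ?exprn_ge0.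
have S10 : 0 <= a ^+ k.+1 + b ^+ k.+1 by rewrite addr_ge0 ?exprn_ge0.
rewrite [leRHS]mulrDl !rhsE -[leRHS]mulrDr.
have [K0|/ltW K0] := leP (1 - 10 * n * (1 + t) * delta) 0.
  apply: (@le_trans _ _ 0).
    apply: mulr_ge0_le0 => //; apply: addr_ge0; apply: mulr_ge0 => //.
      exact: ltW.
    exact: mulr_ge0.
  apply: mulr_ge0; first exact: ltW.
  by apply: addr_ge0; apply: exprn_ge0; exact: q0.
have /(ler_wpM2l (ltW t1)) := lerD (tangent x x0) (tangent y y0).
rewrite -aE -bE; apply: le_trans.
move: Sk S0 S10.
set S := a ^+ k + b ^+ k; set S1 := a ^+ k.+1 + b ^+ k.+1 => SS S0 S10.
(* With [K = n (1 + t) delta], the product [(1 + 2 K) (1 - 10 K)] equals [1 - 8 K - 20 K^2]; this is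
   where the constant 10 comes from. *)
apply: (@le_trans _ _ ((1 + t) * S1 * (1 - 8 * (n * (1 + t) * delta)))).
  have nd0 : 0 <= n * delta by rewrite mulr_ge0.
  apply: (@le_trans _ _ ((1 + t) * S1 * (1 + 2 * (n * (1 + t) * delta))
      * (1 - 10 * n * (1 + t) * delta))).
    have : 0 <= n * delta * ((1 + t) * S1 * t).
      by apply: mulr_ge0 => //; apply: mulr_ge0 => //; apply: mulr_ge0 => //; lra.
    by move=> tS; apply: ler_wpM2r => //; have := ler_wpM2l nd0 SS; lra.
  have -> : 10 * n * (1 + t) * delta = 10 * (n * (1 + t) * delta) by ring.
  set K := n * (1 + t) * delta.
  have : 0 <= (1 + t) * S1 * K ^+ 2.
    by apply: mulr_ge0; [apply: mulr_ge0 => //; exact: ltW | exact: sqr_ge0].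
  by rewrite expr2; lra.
have nd0 : 0 <= 4 * delta * n by rewrite !mulr_ge0 //; lra.
have -> : a ^+ k.+1 - 4 * delta * n * a ^+ k + (b ^+ k.+1 - 4 * delta * n * b ^+ k)
  = S1 - 4 * delta * n * S by rewrite /S /S1; ring.
rewrite -mulrA ler_pM2l //; have := ler_wpM2l nd0 SS; lra.
Qed.

(** * The grid of equal tail masses and the sum over its cells *)

(** The intermediate value theorem on [[0, N]], where [T N <= T 0 / m], reaches every level with
    [l < m]. Level 0, at [l = m], is left out because a tail may never vanish. The levels decrease
    strictly, which orders the chosen points. *)
Lemma tail_grid (R : realType) (T : R -> R) (m : nat) :
  continuous T -> (forall x y : R, x <= y -> T y <= T x) ->
  (forall y, 0 <= T y) -> (forall e : R, 0 < e -> exists2 N : R, 0 <= N & T N <= e) ->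
  exists y : nat -> R, [/\ y 0%N = 0, forall l, 0 <= y l,
    forall l, (l < m)%N -> T (y l) = T 0 * (1 - l%:R / m%:R) &
    forall l, (l.+1 < m)%N -> y l <= y l.+1].
Proof.
move=> cT nT T0 limT.
have [p0|p0] := eqVneq (T 0) 0.
  exists (fun=> 0); split=> // l _; by rewrite p0 mul0r.
have {}p0 : 0 < T 0 by rewrite lt_def p0 T0.
have [->|m0] := posnP m; first by exists (fun=> 0).
have pm0 : 0 < T 0 / m%:R by rewrite divr_gt0 // ltr0n.
have [N N0 TN] := limT _ pm0.
have ex l : exists y : R, 0 <= y /\ ((l < m)%N -> T y = T 0 * (1 - l%:R / m%:R)).
  have [lm|ml] := ltnP l m; last by exists 0.
  have [||y yN Ty] := @IVT R T 0 N (T 0 * (1 - l%:R / m%:R)) N0.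
  - by apply: continuous_subspaceT.
  - have TN0 : T N <= T 0 by exact: nT.
    rewrite min_r // max_l //; apply/andP; split.
      apply: (le_trans TN); rewrite ler_pM2l //.
      rewrite -(ler_pM2r (_ : 0 < m%:R)) ?ltr0n // mulVf ?pnatr_eq0 -?lt0n //.
      rewrite mulrBl mul1r divfK ?pnatr_eq0 -?lt0n // lerBrDr nat1r ler_nat //.
    by rewrite ger_pMr // gerBl divr_ge0 ?ler0n.
  by exists y; split => //; move: yN; rewrite in_itv /= => /andP[].
have {ex}[f fP] := choice ex.
(* The point found for level [T 0] may differ from 0, so index 0 is set by hand. *)
exists (fun l => if l is _.+1 then f l else 0); split=> //.
- by case=> // l; case: (fP l.+1).
- case=> [|l] lm; first by rewrite mul0r subr0 mulr1.
  by case: (fP l.+1) => _; apply.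
- case=> [|l] lm; first by case: (fP 1%N).
  case: (fP l.+1) => f1 /(_ (ltnW lm)) T1; case: (fP l.+2) => f2 /(_ lm) T2.
  rewrite leNgt; apply/negP => /ltW ff.
  have := nT _ _ ff; rewrite T1 T2 ler_pM2l // lerD2l lerN2.
  by rewrite ler_pM2r ?invr_gt0 ?ltr0n // ler_nat ltnn.
Qed.

(** Here [s j l] stands for the mass of estimator [j] beyond grid point [l], and [c i l] for the
    mass allowed to another estimator. The exact tail has equal decrements [p / m.+1], which produce
    a Riemann sum; the deviation [d] of [s] from it is summed by parts and costs [delta] times the
    largest weight. *)
Lemma grid_sum_le (R : realFieldType) (k m : nat) (s c : nat -> nat -> R) (t p delta : R) :
  0 <= t -> 0 <= p -> 0 <= delta ->
  (forall j l, (j < k.+1)%N -> (l <= m)%N ->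
     s j l <= p * (1 - l%:R / m.+1%:R) + delta) ->
  (forall j, (j < k.+1)%N -> s j m.+1 = 0) ->
  (forall j l, (j < k.+1)%N -> (l <= m)%N -> s j l.+1 <= s j l) ->
  (forall j l, (j < k.+1)%N -> (l <= m)%N ->
     0 <= c j l <= p / (1 + t) / m.+1%:R * l%:R + (p / m.+1%:R + 2 * delta)) ->
  \sum_(l < m.+1) \sum_(j < k.+1)
      (s j l - s j l.+1) * \prod_(i < k.+1 | i != j) c i l
  <= (1 + t) * (p / (1 + t) + p / m.+1%:R + 2 * delta) ^+ k.+1
     + k.+1%:R * delta * (p / (1 + t) + p / m.+1%:R + 2 * delta) ^+ k.
Proof.
move=> t0 p0 d0 sle sm snd cle.
have t1 : 0 < 1 + t by lra.
have m0 : 0 < m.+1%:R :> R by rewrite ltr0n.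
have c0 : 0 <= p / (1 + t) / m.+1%:R by rewrite !divr_ge0 // ltW.
have b0 : 0 <= p / m.+1%:R + 2 * delta.
  by rewrite addr_ge0 ?divr_ge0 ?mulr_ge0 // ltW.
set C := p / (1 + t) / m.+1%:R in c0 cle *.
set b := p / m.+1%:R + 2 * delta in b0 cle *.
have h0 l : 0 <= C * l%:R + b.
  by apply: addr_ge0 => //; apply: mulr_ge0.
have -> : p / (1 + t) + p / m.+1%:R + 2 * delta = C * m.+1%:R + b.
  by rewrite /C /b divfK ?gt_eqF // addrA.
set H := C * m.+1%:R + b; pose h l := (C * l%:R + b) ^+ k.
have hS l : h l <= h l.+1.
  rewrite /h lerXn2r ?nnegrE ?h0 // lerD2r ler_wpM2l // ler_nat //.
apply: (@le_trans _ _ (\sum_(j < k.+1) \sum_(l < m.+1) (s j l - s j l.+1) * h l)).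
  rewrite exchange_big; apply: ler_sum => j _; apply: ler_sum => l _.
  have lm : (l <= m)%N by rewrite -ltnS.
  apply: ler_wpM2l; first by rewrite subr_ge0 snd.
  have -> : h l = \prod_(i < k.+1 | i != j) (C * l%:R + b).
    rewrite prodr_const /h; congr (_ ^+ _).
    by rewrite cardC1 card_ord.
  by apply: ler_prod => i _; exact: cle.
have step (j : 'I_k.+1) : \sum_(l < m.+1) (s j l - s j l.+1) * h l
    <= p / m.+1%:R * (\sum_(l < m.+1) h l) + delta * H ^+ k.
  pose d l := s j l - p * (1 - l%:R / m.+1%:R).
  have dle l : (l <= m)%N -> d l <= delta.
    by move=> lm; rewrite /d lerBlDl sle.
  have := @abel_sum_le R d h delta m dle (exprn_ge0 _ (h0 0%N)) hS.
  have -> : d m.+1 = 0 by rewrite /d sm // divff ?gt_eqF // subrr mulr0 subr0.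
  rewrite subr0.
  have -> : \sum_(l < m.+1) (d l - d l.+1) * h l =
     \sum_(l < m.+1) (s j l - s j l.+1) * h l - p / m.+1%:R * \sum_(l < m.+1) h l.
    rewrite mulr_sumr -sumrB; apply: eq_bigr => l _.
    by rewrite /d -[in l.+1%:R]natr1; field; rewrite gt_eqF.
  move=> le1; rewrite -lerBlDl; apply: (le_trans le1).
  by apply: ler_wpM2l => //; exact: (hS m).
apply: (le_trans (ler_sum _ (fun j _ => step j))).
rewrite sumr_const card_ord -[leLHS]mulr_natl mulrDr [in leLHS]mulrA lerD ?mulrA //.
have := @sum_expr_arith_le R b C k m.+1 b0 c0; rewrite -/H => /(ler_wpM2l (ltW t1)).
apply: le_trans; rewrite le_eqVlt; apply/orP; left; apply/eqP.
rewrite /h /C; field.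
by rewrite !gt_eqF.
Qed.

(** * Real-valued probabilities and independence on rectangles *)

Section probability.
Context d (T : measurableType d) (R : realType) (P : probability T R).

Lemma fine_probability_le (A B : set T) : measurable A -> measurable B ->
  A `<=` B -> fine (P A) <= fine (P B).
Proof.
by move=> mA mB AB; rewrite fine_le ?fin_num_measure // le_measure ?inE.
Qed.

Lemma fine_probability_Boole (A : nat -> set T) (n : nat) :
  (forall i, (i < n)%N -> measurable (A i)) ->
  fine (P (\big[setU/set0]_(i < n) A i)) <= \sum_(i < n) fine (P (A i)).
Proof.
elim: n => [|n IH] mA; first by rewrite !big_ord0 measure0.
have mU : measurable (\big[setU/set0]_(i < n) A i).
  by apply: bigsetU_measurable => i _; apply: mA; rewrite ltnS ltnW.
rewrite !big_ord_recr /=; apply: (@le_trans _ _ (fine (P (\big[setU/set0]_(i < n) A i)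
  + P (A n))%E)).
  rewrite fine_le ?fin_numD ?fin_num_measure ?measureU2 //;
    try exact: mA; apply: measurableU => //; exact: mA.
rewrite fineD ?fin_num_measure //; last exact: mA.
by rewrite lerD2r IH // => i ni; apply: mA; rewrite ltnW.
Qed.

Lemma fine_probabilityD (A B : set T) : measurable A -> measurable B ->
  B `<=` A -> fine (P (A `\` B)) = fine (P A) - fine (P B).
Proof.
move=> mA mB BA; rewrite measureD ?ltey_eq ?fin_num_measure //.
by rewrite (setIidr BA) fineB ?fin_num_measure.
Qed.

(** The independent family has [U] at index 0 and the estimators shifted by one, so the conditions
    on [U] and on the estimators form one rectangle with [n.+1] sides. *)
Lemma independent_rect (n : nat) (U : T -> R) (X : nat -> T -> R)
    (A : set R) (C : nat -> set R) :
  mutually_independent P n.+1 (fun i => if i is i'.+1 then X i' else U) ->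
  measurable A -> (forall i, measurable (C i)) ->
  measurable_fun setT U -> (forall i, measurable_fun setT (X i)) ->
  let E := U @^-1` A `&` [set w | forall i, (i < n)%N -> C i (X i w)] in
  measurable E /\
  fine (P E) = fine (P (U @^-1` A)) * \prod_(i < n) fine (P (X i @^-1` C i)).
Proof.
move=> ind mA mC mU mX E.
pose AA i := if i is i'.+1 then C i' else A.
have mAA i : measurable (AA i) by case: i => [|i]; [exact: mA|exact: mC].
pose Z i := if i is i'.+1 then X i' else U.
have mZ i : measurable (Z i @^-1` AA i).
  rewrite -[X in measurable X]setTI.
  by case: i => [|i] /=; [exact: mU|exact: mX].
have EE : E = \bigcap_(i in [set i | (i < n.+1)%N]) (Z i @^-1` AA i).
  apply/seteqP; split=> w /=.
    by move=> [Aw Cw] [|i] //= ni; exact: Cw.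
  move=> Zw; split; first exact: (Zw 0%N).
  by move=> i ni; exact: (Zw i.+1).
have fZ i : P (Z i @^-1` AA i) = (fine (P (Z i @^-1` AA i)))%:E.
  by rewrite fineK ?fin_num_measure.
split.
  rewrite EE; apply: bigcap_measurable => //.
  by exists 0%N.
rewrite EE (ind AA mAA) (eq_bigr (fun i : 'I_n.+1 => (fine (P (Z i @^-1` AA i)))%:E)).
  by rewrite prodEFin /= big_ord_recl.
by move=> i _; exact: fZ.
Qed.

End probability.

(** * Distribution functions: tails, reflection and continuity *)

Lemma measurable_gt_ray (R : realType) (y : R) : measurable [set x : R | y < x].
Proof.
rewrite [X in measurable X](_ : _ = `]y, +oo[%classic); first exact: measurable_itv.
by apply/seteqP; split => x /=; rewrite in_itv /= andbT.
Qed.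

Section distribution_function.
Context d (T : measurableType d) (R : realType) (P : probability T R).
Variable X : T -> R.
Hypothesis mX : measurable_fun setT X.

Lemma measurable_gt_event (y : R) : measurable [set w | y < X w].
Proof. by rewrite -[X in measurable X]setTI; exact: mX (measurable_gt_ray _ _). Qed.

Lemma measurable_le_event (y : R) : measurable [set w | X w <= y].
Proof.
rewrite (_ : [set w | X w <= y] = ~` [set w | y < X w]).
  exact: measurableC (measurable_gt_event _).
by apply/seteqP; split=> w /=; rewrite ltNge; [move=> -> | move/negP; rewrite negbK].
Qed.

Lemma fine_probability_gt (y : R) : fine (P [set w | y < X w]) = 1 - distr_fun P X y.
Proof.
rewrite (_ : [set w | y < X w] = setT `\` [set w | X w <= y]).
  rewrite fine_probabilityD //; last exact: measurable_le_event.
  by rewrite probability_setT.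
by apply/seteqP; split=> w /=; rewrite ltNge; [move/negP | move=> [_ /negP]].
Qed.

Lemma distr_fun_ge0 (y : R) : 0 <= distr_fun P X y.
Proof. exact: fine_ge0. Qed.

Lemma distr_fun_le1 (y : R) : distr_fun P X y <= 1.
Proof. by rewrite -subr_ge0 -fine_probability_gt fine_ge0. Qed.

Lemma distr_fun_nd (x y : R) : x <= y -> distr_fun P X x <= distr_fun P X y.
Proof.
move=> xy; apply: fine_probability_le; try exact: measurable_le_event.
by move=> w /= /le_trans; apply.
Qed.

(** Bundling [X] as a random variable gives access to right continuity and the limit at infinity of
    [cdf]. *)
Lemma distr_fun_cdf : exists X' : {RV P >-> R}, distr_fun P X = fine \o cdf X'.
Proof.
pose X1 := isMeasurableFun.Build _ _ _ _ X mX.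
pose X' : {RV P >-> R} := HB.pack X X1.
exists X'; apply/funext => y; congr (fine (P _)).
Qed.

Lemma distr_fun_right_continuous (x : R) : distr_fun P X @ x^'+ --> distr_fun P X x.
Proof.
have [X' ->] := distr_fun_cdf; apply: fine_cvg.
by rewrite fineK ?fin_num_measure //; exact: cdf_right_continuous.
Qed.

Lemma distr_fun_tail0 (e : R) : 0 < e -> exists2 N : R, 0 <= N & 1 - distr_fun P X N <= e.
Proof.
move=> e0; have [X' XE] := distr_fun_cdf.
have : distr_fun P X @ +oo --> (1 : R) by rewrite XE; exact/fine_cvg/cvg_cdfy1.
move=> /cvgrPdist_le /(_ _ e0) [N [_ HN]].
exists (Num.max 0 (N + 1)); first by rewrite le_max lexx.
have /HN : N < Num.max 0 (N + 1) by rewrite lt_max ltrDl ltr01 orbT.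
by apply: le_trans; exact: ler_norm.
Qed.

Hypothesis cX : continuous_rv P X.

(** The events [- y <= X] and [- y < X] differ by an atom, which has mass 0. *)
Lemma distr_fun_opp (y : R) : distr_fun P (fun w => - X w) y = 1 - distr_fun P X (- y).
Proof.
rewrite -fine_probability_gt /distr_fun.
have mEq : measurable [set w | X w = - y].
  rewrite (_ : [set w | X w = - y] = X @^-1` [set - y]) //.
  by rewrite -[X in measurable X]setTI; exact: mX (measurable_set1 _).
rewrite (_ : [set w | - X w <= y] = [set w | - y < X w] `|` [set w | X w = - y]).
  have dis : [set w | - y < X w] `&` [set w | X w = - y] = set0.
    by apply/seteqP; split=> w //= [] /[swap] ->; rewrite ltxx.
  by rewrite (measureU P (measurable_gt_event _) mEq dis) [X in (_ + X)%E](cX (- y)) adde0.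
apply/seteqP; split=> w /=; rewrite lerNl le_eqVlt.
  by case/orP=> [/eqP->|]; [right|left].
by case=> [->|->]; rewrite ?orbT ?eqxx.
Qed.

End distribution_function.

(** Left continuity is right continuity of the distribution function of [- X], by reflection. *)
Lemma distr_fun_continuous d (T : measurableType d) (R : realType)
    (P : probability T R) (X : T -> R) :
  measurable_fun setT X -> continuous_rv P X -> continuous (distr_fun P X).
Proof.
move=> mX cX x; apply/left_right_continuousP; split; last first.
  exact: distr_fun_right_continuous.
have mN : measurable_fun setT (fun w => - X w) by exact: measurable_funN.
apply/cvg_at_leftNP.
have E : distr_fun P X \o -%R = fun y => 1 - distr_fun P (fun w => - X w) y.
  by apply/funext => y /=; rewrite distr_fun_opp //; ring.
rewrite E.
have -> : distr_fun P X x = 1 - distr_fun P (fun w => - X w) (- x).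
  by rewrite distr_fun_opp // opprK; ring.
apply: cvgB; first exact: cvg_cst.
exact: distr_fun_right_continuous.
Qed.

(** * The probability of missing on one side *)

(** For [x i = r (th i - theta0)] this says that [theta0] lies below the interval: the binding pair
    is the minimum for [i] and the maximum for [j]. Ranging over all pairs makes it a finite
    intersection; the case [i = j] forces [x i > 0]. *)
Definition one_sided_miss (R : realType) (k : nat) (t : R) (x : nat -> R) : Prop :=
  forall i j, (i < k.+1)%N -> (j < k.+1)%N -> t * x j < (1 + t) * x i.

Lemma measurable_one_sided_miss d (T : measurableType d) (R : realType) (k : nat)
    (t : R) (X : nat -> T -> R) : (forall i, measurable_fun setT (X i)) ->
  measurable [set w | one_sided_miss R k t (fun i => X i w)].
Proof.
move=> mX.
rewrite (_ : [set w | _] = \bigcap_(i in [set i | (i < k.+1)%N])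
  \bigcap_(j in [set j | (j < k.+1)%N]) [set w | 0 < (1 + t) * X i w - t * X j w]).
  apply: bigcap_measurable => [|i _]; first by exists 0%N.
  apply: bigcap_measurable => [|j _]; first by exists 0%N.
  apply: (@measurable_gt_event _ _ _ (fun w => (1 + t) * X i w - t * X j w)).
  by apply: measurable_funB; apply: measurable_funM => //; exact: mX.
apply/seteqP; split=> w /= miss i.
  by move=> ik j jk /=; rewrite subr_gt0; exact: miss.
by move=> j ik jk; have := miss i ik j jk; rewrite /= subr_gt0.
Qed.

(* [Tl] is the tail function of [W] or of [- W]. *)
Lemma one_sided_miss_le d (T : measurableType d) (R : realType)
    (P : probability T R) (k : nat) (U : T -> R) (X : nat -> T -> R) (A : set R)
    (Tl : R -> R) (t delta : R) :
  mutually_independent P k.+2 (fun i => if i is i'.+1 then X i' else U) ->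
  measurable A -> measurable_fun setT U -> (forall i, measurable_fun setT (X i)) ->
  0 <= t -> 0 < delta -> continuous Tl -> (forall x y, x <= y -> Tl y <= Tl x) ->
  (forall y, 0 <= Tl y) -> (forall e : R, 0 < e -> exists2 N : R, 0 <= N & Tl N <= e) ->
  (forall y, 0 <= y -> Tl (t / (1 + t) * y) <= t / (1 + t) * Tl y + (1 + t)^-1 * Tl 0) ->
  (forall j y, (j < k.+1)%N -> 0 <= y ->
     `|fine (P [set w | y < X j w]) - Tl y| <= delta) ->
  fine (P (U @^-1` A `&` [set w | one_sided_miss R k t (fun i => X i w)]))
  <= fine (P (U @^-1` A)) * ((1 + t) * (Tl 0 / (1 + t) + 4 * delta) ^+ k.+1
       + k.+1%:R * delta * (Tl 0 / (1 + t) + 4 * delta) ^+ k).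
Proof.
move=> ind mA mU mX t0 d0 cT nT T0 limT cvxT near_T.
have mE : measurable (U @^-1` A `&` [set w | one_sided_miss R k t (fun i => X i w)]).
  apply: measurableI; last exact: measurable_one_sided_miss.
  by rewrite -[X in measurable X]setTI; exact: mU.
set p := Tl 0 in cvxT *.
have t1 : 0 < 1 + t by lra.
(* The mesh is so fine that discretisation costs at most [2 delta]; with another [2 delta] from the
   two ends of [D l] this makes [4 delta]. Positivity of [delta] enters here. *)
have [m pm] : exists m : nat, p / m.+1%:R <= 2 * delta.
  exists (Num.truncn (p / (2 * delta))).
  rewrite ler_pdivrMr ?ltr0n // mulrC -ler_pdivrMr; last by lra.
  by rewrite ltW // truncnS_gt.
have m0 : 0 < m.+1%:R :> R by rewrite ltr0n.
have [y [y0 yge0 Ty ynd]] := @tail_grid R Tl m.+1 cT nT T0 limT.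
rewrite -/p in Ty.
set tau := t / (1 + t) in cvxT *.
have tau0 : 0 <= tau by rewrite divr_ge0 // ltW.
have tau1 : tau <= 1 by rewrite ler_pdivrMr // mul1r; lra.
(* [S 0, ..., S m.+1] decreases from the positive half-line to the empty set; cell
   number [l] is the difference of [S l] and [S l.+1]. *)
pose S l := if (l < m.+1)%N then [set x | y l < x] else set0.
have mS l : measurable (S l).
  by rewrite /S; case: ifP => _; [exact: measurable_gt_ray | exact: measurable0].
have SS l : (l <= m)%N -> S l.+1 `<=` S l.
  move=> lm; rewrite /S (lm : (l < m.+1)%N); case: ifP => [lm1|_] x //=.
  exact: le_lt_trans (ynd _ lm1).
(* When the largest value lies in cell [l], every other one exceeds [tau] times it, hence
   [tau * y l], and does not pass the end of the cell. *)
pose D l := [set x | tau * y l < x] `\` S l.+1.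
have mD l : measurable (D l) by exact: measurableD (measurable_gt_ray _ _) (mS _).
have SD l : (l <= m)%N -> S l.+1 `<=` [set x | tau * y l < x].
  move=> lm x /(SS _ lm); rewrite /S (lm : (l < m.+1)%N) /= => yx.
  by apply: le_lt_trans yx; exact: ler_piMl.
have mXS i (C : set R) : measurable C -> measurable (X i @^-1` C).
  by move=> mC; rewrite -[X in measurable X]setTI; exact: mX.
pose s j l := fine (P (X j @^-1` S l)).
pose c j l := fine (P (X j @^-1` D l)).
have near_s j l : (j < k.+1)%N -> (l <= m.+1)%N ->
    `|s j l - p * (1 - l%:R / m.+1%:R)| <= delta.
  move=> jk; rewrite /s /S leq_eqVlt => /orP[/eqP->|lm].
    rewrite ltnn preimage_set0 measure0 divff ?gt_eqF // subrr mulr0 subrr normr0.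
    exact: ltW.
  by rewrite lm -Ty //; exact: near_T.
have s_top j : s j m.+1 = 0 by rewrite /s /S ltnn preimage_set0 measure0.
have sS j l : (l <= m)%N -> s j l.+1 <= s j l.
  move=> lm; apply: fine_probability_le; try exact: mXS.
  by move=> w; exact: SS.
(* Convexity of the tail bounds [Tl (tau * y l)] by a mixture of [Tl (y l)] and [p]; each of the two
   ends of [D l] adds one [delta]. *)
have c_le j l : (j < k.+1)%N -> (l <= m)%N ->
    0 <= c j l <= p / (1 + t) / m.+1%:R * l%:R + (p / m.+1%:R + 2 * delta).
  move=> jk lm; rewrite fine_ge0 //=.
  rewrite /c [X j @^-1` _](_ : _ = [set w | tau * y l < X j w] `\` X j @^-1` S l.+1) //.
  rewrite fine_probabilityD; [|exact: mXS (measurable_gt_ray _ _)|exact: mXS|]; last first.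
    by move=> w; exact: SD.
  have /ler_normlP[_ h1] := near_T j (tau * y l) jk (mulr_ge0 tau0 (yge0 l)).
  have /ler_normlP[h2 _] := near_s j l.+1 jk lm.
  have := cvxT _ (yge0 l); rewrite Ty // => h3.
  have -> : p / (1 + t) / m.+1%:R * l%:R + (p / m.+1%:R + 2 * delta)
    = tau * (p * (1 - l%:R / m.+1%:R)) + (1 + t)^-1 * p
      - p * (1 - l.+1%:R / m.+1%:R) + 2 * delta.
    by rewrite /tau -[in l.+1%:R]natr1; field; rewrite !gt_eqF.
  rewrite -/(s j l.+1); move: h1 h2 h3.
  move: (fine _) (Tl (tau * _)) (s j l.+1) (p * _) (tau * _ + _) => u1 u2 u3 u4 u5.
  by lra.
(* In [cell l j] the largest estimator is number [j] and lies in cell number [l]. *)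
pose C l (j i : nat) := if i == j then S l `\` S l.+1 else D l.
pose cell l j := U @^-1` A `&` [set w | forall i, (i < k.+1)%N -> C l j i (X i w)].
have cellP l j := @independent_rect d T R P k.+1 U X A (C l j) ind mA.
have {}cellP l j : (l <= m)%N -> (j < k.+1)%N -> measurable (cell l j) /\
    fine (P (cell l j)) = fine (P (U @^-1` A)) *
      ((s j l - s j l.+1) * \prod_(i < k.+1 | i != j :> nat) c i l).
  move=> lm jk.
  have mC i : measurable (C l j i).
    by rewrite /C; case: ifP => _; [exact: measurableD (mS _) (mS _) | exact: mD].
  have [mcell ->] := cellP l j mC mU mX; split => //; congr (_ * _).
  rewrite (bigD1 (Ordinal jk)) //=; congr (_ * _).
    rewrite /C eqxx -fine_probabilityD //; try exact: mXS.
    by move=> w; exact: SS.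
  by apply: eq_bigr => i ij; rewrite /C (negPf (ij : (i : nat) != j)).
have cover : U @^-1` A `&` [set w | one_sided_miss R k t (fun i => X i w)]
    `<=` \big[setU/set0]_(l < m.+1) \big[setU/set0]_(j < k.+1) cell l j.
  move=> w [Aw Xw].
  (* Any index of the maximum will do, since the cells only have to cover the event before Boole's
     inequality; [l] is then the last grid point below that maximum. *)
  have [j _ jmax] := @arg_maxP _ _ _ (ord0 : 'I_k.+1) predT (fun i : 'I_k.+1 => X i w) isT.
  have Xj0 : 0 < X j w by have := Xw j j (ltn_ord j) (ltn_ord j); lra.
  have ex0 : exists l, (l <= m)%N && (y l < X j w) by exists 0%N; rewrite y0.
  have bnd l : (l <= m)%N && (y l < X j w) -> (l <= m)%N by case/andP.
  case: (ex_maxnP ex0 bnd) => l /andP[lm yl] lmax.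
  have nS : ~ S l.+1 (X j w).
    rewrite /S; case: ifP => [lm1 /= yS|_ []].
    by have := lmax l.+1; rewrite ltnn yS -ltnS lm1; move=> /(_ isT).
  rewrite -(bigcup_mkord m.+1 (fun l => \big[setU/set0]_(j < k.+1) cell l j)).
  exists l; first exact: lm.
  rewrite -(bigcup_mkord k.+1 (cell l)); exists (j : nat); first exact: ltn_ord.
  split=> // i ik /=; rewrite /C; case: ifP => [/eqP ->|_].
    by split => //; rewrite /S (lm : (l < m.+1)%N).
  split=> /=.
    apply: (@le_lt_trans _ _ (tau * X j w)).
      by apply: ler_wpM2l => //; exact: ltW.
    by rewrite /tau mulrAC ltr_pdivrMr // [ltRHS]mulrC; exact: Xw.
  apply: contra_not nS; rewrite /S; case: ifP => [_ /= /lt_le_trans|_ []]; apply.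
  exact: (jmax (Ordinal ik)).
have mcells l : (l < m.+1)%N -> measurable (\big[setU/set0]_(j < k.+1) cell l j).
  by move=> lm; apply: bigsetU_measurable => j _; case: (cellP l j lm (ltn_ord j)).
apply: (@le_trans _ _ (\sum_(l < m.+1) \sum_(j < k.+1) fine (P (cell l j)))).
  apply: (le_trans (fine_probability_le _ _ _ _ _ _ mE _ cover)).
    by apply: bigsetU_measurable => l _; exact: mcells.
  apply: (le_trans (fine_probability_Boole _ _ _ _ _ _ mcells)).
  apply: ler_sum => l _; apply: fine_probability_Boole => j jk.
  by case: (cellP l j (ltn_ord l) jk).
rewrite (eq_bigr (fun l : 'I_m.+1 => fine (P (U @^-1` A)) * \sum_(j < k.+1)
  (s j l - s j l.+1) * \prod_(i < k.+1 | i != j) c i l)); last first.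
  move=> l _; rewrite mulr_sumr; apply: eq_bigr => j _.
  by case: (cellP l j (ltn_ord l) (ltn_ord j)).
rewrite -mulr_sumr; apply: ler_wpM2l; first exact: fine_ge0.
have sle j l : (j < k.+1)%N -> (l <= m)%N -> s j l <= p * (1 - l%:R / m.+1%:R) + delta.
  by move=> jk lm; have /ler_normlP[_] := near_s j l jk (leqW lm); rewrite lerBlDl.
apply: (le_trans (@grid_sum_le R k m s c t p delta t0 (T0 0) (ltW d0) sle
  (fun j _ => s_top j) (fun j l _ => sS j l) c_le)).
have Hp : 0 <= p / (1 + t) + p / m.+1%:R + 2 * delta.
  by rewrite !addr_ge0 ?divr_ge0 ?T0 // ?ltW //; lra.
have Hle : p / (1 + t) + p / m.+1%:R + 2 * delta <= p / (1 + t) + 4 * delta.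
  by rewrite -addrA lerD2l (_ : 4 * delta = 2 * delta + 2 * delta) ?lerD2r //; ring.
have nd : 0 <= k.+1%:R * delta by rewrite mulr_ge0 ?ltW.
apply: lerD; apply: ler_wpM2l => //; try exact: ltW;
  by rewrite lerXn2r ?nnegrE //; exact: le_trans Hle.
Qed.

(** * Reduction of a missed interval to the two one-sided events *)

Section extrema.
Context (R : realType) (th : nat -> nat -> R) (k : nat).

Lemma th_max_ge i : (i < k.+1)%N -> th k.+1 i <= th_max th k.+1.
Proof.
by move=> ik; rewrite /th_max; apply: (le_bigmax _ (fun i : 'I_k.+1 => th k.+1 i) (Ordinal ik)).
Qed.

Lemma th_min_le i : (i < k.+1)%N -> th_min th k.+1 <= th k.+1 i.
Proof.
by move=> ik; exact: (bigmin_le _ (Ordinal ik) (fun i : 'I_k.+1 => th k.+1 i)).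
Qed.

(** The default value [th k.+1 0] of the big operator is itself one of the estimators. *)
Lemma th_max_attained : exists2 i, (i < k.+1)%N & th_max th k.+1 = th k.+1 i.
Proof.
rewrite /th_max; elim/big_ind: _ => [|x y ex ey|i _]; first by exists 0%N.
  by rewrite maxEle; case: ifP.
by exists i.
Qed.

Lemma th_min_attained : exists2 i, (i < k.+1)%N & th_min th k.+1 = th k.+1 i.
Proof.
rewrite /th_min; elim/big_ind: _ => [|x y ex ey|i _]; first by exists 0%N.
  by rewrite minEle; case: ifP.
by exists i.
Qed.

Lemma notin_CI_iff (t theta0 r : R) : 0 <= t -> 0 < r ->
  ~ in_CI t theta0 th k.+1 <->
  one_sided_miss R k t (fun i => r * (th k.+1 i - theta0)) \/
  one_sided_miss R k t (fun i => - (r * (th k.+1 i - theta0))).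
Proof.
move=> t0 r0; rewrite /in_CI.
have [a ak aE] := th_max_attained; have [b bk bE] := th_min_attained.
(* The sign [s], 1 or -1, selects the side; the positive factor [r] cancels. *)
have one_sidedE (s : R) (x : nat -> R) i j :
    (t * (s * (r * (x j - theta0))) < (1 + t) * (s * (r * (x i - theta0))))
    = (0 < s * ((1 + t) * (x i - theta0) - t * (x j - theta0))).
  rewrite -subr_gt0 -[RHS](pmulr_rgt0 _ r0); congr (_ < _); ring.
split.
  move/negP; rewrite negb_and -!ltNge => /orP[lt0|gt0]; [left|right] => i j ik jk.
    have := one_sidedE 1 (th k.+1) i j; rewrite !mul1r => ->.
    have := th_min_le _ ik; have /(ler_wpM2l t0) := th_max_ge _ jk.
    by have /(ler_wpM2l t0) := th_min_le _ ik; lra.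
  have := one_sidedE (-1) (th k.+1) i j; rewrite !mulN1r => ->.
  have := th_max_ge _ ik; have /(ler_wpM2l t0) := th_min_le _ jk.
  by have /(ler_wpM2l t0) := th_max_ge _ ik; lra.
case=> miss; apply/negP; rewrite negb_and -!ltNge.
  apply/orP; left; have := miss b a bk ak.
  have := one_sidedE 1 (th k.+1) b a; rewrite !mul1r => ->.
  by rewrite aE bE; lra.
apply/orP; right; have := miss a b ak bk.
have := one_sidedE (-1) (th k.+1) a b; rewrite !mulN1r => ->.
by rewrite aE bE; lra.
Qed.

End extrema.

(** * Miscoverage with a fixed number of splits *)

Lemma mutually_independent_comp d (T : measurableType d) (R : realType)
    (P : probability T R) (n : nat) (X : nat -> T -> R) (f : nat -> R -> R) :
  (forall i, measurable_fun setT (f i)) ->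
  mutually_independent P n X ->
  mutually_independent P n (fun i w => f i (X i w)).
Proof.
move=> mf ind A mA; apply: (ind (fun i => f i @^-1` A i)) => i.
by rewrite -[X in measurable X]setTI; exact: mf.
Qed.

(** The numbers [1/2 - Delta] and [1/2 + Delta] are [q] and [1 - q] in one order or the other, and
    [Pfun] is symmetric in them. *)
Lemma Qfun_split (R : realType) (t Delta q : R) (k : nat) : 0 <= t ->
  Delta = `|2^-1 - q| ->
  Qfun k.+1 t Delta = ((1 - q) ^+ k.+1 + q ^+ k.+1) / (1 + t) ^+ k.
Proof.
move=> t0 ->; rewrite /Qfun /Pfun.
have -> : (1 - k.+1%:Z)%R = - k%:Z by rewrite intS opprD addrA subrr add0r.
rewrite exprnN; congr (_ * _).
case: ger0P => _.
  by rewrite [LHS]addrC; congr (_ ^+ _ + _ ^+ _); lra.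
by congr (_ ^+ _ + _ ^+ _); lra.
Qed.

(** The event that [U] lies in [A] is carried along so that the two split counts can be combined
    later. The product form stays meaningful when the factor on the left is nonpositive. *)
Lemma miscoverage_le (R : realType) (t Delta : R) (k : nat)
    (d : measure_display) (T : measurableType d) (P : probability T R)
    (d' : measure_display) (T' : measurableType d') (PW : probability T' R)
    (U : T -> R) (th : nat -> nat -> T -> R) (theta0 r delta : R) (W : T' -> R)
    (A : set R) :
  0 <= t -> measurable_fun setT U -> (forall i, measurable_fun setT (th k.+1 i)) ->
  (forall i, (i < k.+1)%N -> continuous_rv P (th k.+1 i)) ->
  mutually_independent P k.+2 (fun i => if i is i'.+1 then th k.+1 i' else U) ->
  measurable_fun setT W -> continuous_rv PW W -> unimodal_at0 PW W ->
  Delta = `|2^-1 - distr_fun PW W 0| -> 0 < r -> 0 < delta ->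
  (forall j, (j < k.+1)%N -> forall u : R,
     `|distr_fun P (fun w => r * (th k.+1 j w - theta0)) u - distr_fun PW W u| <= delta) ->
  measurable A ->
  let E := U @^-1` A `&` [set w | ~ in_CI t theta0 (fun k j => th k j w) k.+1] in
  measurable E /\
  fine (P E) * (1 - 10 * k.+1%:R * (1 + t) * delta)
    <= fine (P (U @^-1` A)) * Qfun k.+1 t Delta.
Proof.
move=> t0 mU mth cth ind mW cW [cvx ccv] DE r0 d0 near mA E.
have t1 : 0 < 1 + t by lra.
pose X s i w : R := s * (r * (th k.+1 i w - theta0)).
have mf (s : R) i : measurable_fun setT
    (if i is _.+1 then fun x : R => s * (r * (x - theta0)) else id).
  case: i => [|i]; first exact: measurable_id.
  by do 2! (apply: measurable_funM; first exact: measurable_cst);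
    apply: measurable_funB; [exact: measurable_id|exact: measurable_cst].
have indX s : mutually_independent P k.+2 (fun i => if i is i'.+1 then X s i' else U).
  have := mutually_independent_comp _ _ _ _ _ _ _ (mf s) ind.
  by congr mutually_independent; apply/funext; case.
have mX s i : measurable_fun setT (X s i).
  exact: (measurableT_comp (mf s i.+1) (mth i)).
have cX i : (i < k.+1)%N -> continuous_rv P (X 1 i).
  move=> ik x; rewrite -(cth i ik (x / r + theta0)); congr (P _).
  apply/seteqP; split=> w /=; rewrite /X mul1r.
    by move<-; field; rewrite gt_eqF.
  by move->; field; rewrite gt_eqF.
have X1E i : X 1 i = (fun w => r * (th k.+1 i w - theta0)).
  by apply/funext => w; rewrite /X mul1r.
have XNE i : X (-1) i = (fun w => - X 1 i w).
  by apply/funext => w; rewrite /X mul1r mulN1r.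
pose M s := U @^-1` A `&` [set w | one_sided_miss R k t (fun i => X s i w)].
have mUA : measurable (U @^-1` A) by rewrite -[X in measurable X]setTI; exact: mU.
have mM s : measurable (M s).
  by apply: measurableI => //; exact: measurable_one_sided_miss.
have EE : E = M 1 `|` M (-1).
  rewrite /M -setIUr; congr (_ `&` _); apply/seteqP; split=> w /=.
    move/(notin_CI_iff _ _ _ _ _ r t0 r0); case=> miss; [left|right] => i j ik jk.
      by rewrite !X1E; exact: miss.
    by rewrite !XNE !X1E; exact: miss.
  move=> miss; apply/(notin_CI_iff _ _ _ _ _ r t0 r0).
  case: miss => miss; [left|right] => i j ik jk; have := miss i j ik jk.
    by rewrite !X1E.
  by rewrite !XNE !X1E.
have tauE : 1 - t / (1 + t) = (1 + t)^-1 by field; rewrite gt_eqF.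
have tau01 : 0 <= t / (1 + t) <= 1.
  by apply/andP; split; [rewrite divr_ge0 // ltW | rewrite ler_pdivrMr // mul1r lerDr].
set F := distr_fun PW W in cvx ccv DE near.
have cF : continuous F by exact: distr_fun_continuous.
have mNW : measurable_fun setT (fun w => - W w) by exact: measurable_funN.
(* The positive side uses the tail of [W], the negative side that of [- W]. Concavity of [F] on the
   right and convexity on the left each make the tail convex on the half-line; this is applied
   between [y] and 0 with weight [t / (1 + t)]. *)
have pos := one_sided_miss_le _ _ _ P k U (X 1) A (fun y => 1 - F y) t delta
  (indX 1) mA mU (mX 1) t0 d0.
have neg := one_sided_miss_le _ _ _ P k U (X (-1)) A (fun y => F (- y)) t delta
  (indX (-1)) mA mU (mX (-1)) t0 d0.
split; first by rewrite EE; exact: measurableU.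
rewrite oppr0 in neg.
have PE : fine (P E) <= fine (P (M 1)) + fine (P (M (-1))).
  rewrite EE -fineD ?fin_num_measure // fine_le ?fin_numD ?fin_num_measure ?measureU2 //.
  exact: measurableU.
have {pos neg}PE2 : fine (P E) <= fine (P (U @^-1` A)) *
   ((1 + t) * (((1 - F 0) / (1 + t) + 4 * delta) ^+ k.+1
               + (F 0 / (1 + t) + 4 * delta) ^+ k.+1)
     + k.+1%:R * delta * (((1 - F 0) / (1 + t) + 4 * delta) ^+ k
                          + (F 0 / (1 + t) + 4 * delta) ^+ k)).
  apply: (le_trans PE).
  apply: (le_trans (lerD (pos _ _ _ _ _ _) (neg _ _ _ _ _ _))).
  - move=> y; apply: cvgB; [exact: cvg_cst|exact: cF].
  - by move=> x y xy; rewrite lerD2l lerN2; exact: distr_fun_nd.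
  - by move=> y; rewrite subr_ge0; exact: distr_fun_le1.
  - by move=> e e0; exact: distr_fun_tail0.
  - move=> y y0; have := ccv y 0 _ y0 (lexx _) tau01.
    move: tauE; rewrite mulr0 addr0; set tau := t / (1 + t) => <-.
    by move: (F (_ * y)) => u; lra.
  - move=> j y jk _; rewrite fine_probability_gt // X1E.
    move: (near j jk y); rewrite -normrN opprB.
    by rewrite (_ : forall a b : R, 1 - a - (1 - b) = b - a) // => a b; ring.
  - by move=> y; apply: (@continuous_comp _ _ _ -%R F); [exact: oppr_continuous|exact: cF].
  - by move=> x y xy; apply: distr_fun_nd => //; rewrite lerN2.
  - by move=> y; exact: distr_fun_ge0.
  - move=> e e0; have [N N0 NE] := @distr_fun_tail0 _ _ _ PW _ mNW _ e0.
    exists N => //; apply: le_trans NE; rewrite distr_fun_opp // /F; lra.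
  - move=> y y0; have y0' : - y <= 0 by rewrite oppr_le0.
    have := cvx (- y) 0 _ y0' (lexx _) tau01.
    by rewrite mulr0 addr0 tauE mulrN.
  - move=> j y jk _; rewrite fine_probability_gt // XNE distr_fun_opp //; last exact: cX.
    rewrite X1E; move: (near j jk (- y)).
    by rewrite (_ : forall a : R, 1 - (1 - a) = a) // => a; ring.
  - by rewrite -mulrDr ler_wpM2l ?fine_ge0 // le_eqVlt; apply/orP; left; apply/eqP; ring.
have F0 : 0 <= F 0 by exact: distr_fun_ge0.
have F1 : 0 <= 1 - F 0 by rewrite subr_ge0; exact: distr_fun_le1.
have pA0 : 0 <= fine (P (U @^-1` A)) by exact: fine_ge0.
have F01 : 1 - F 0 + F 0 = 1 by ring.
have bnd := two_sided_bound_le _ t delta _ _ _ _ k t0 (ltW d0) F1 F0 F01 erefl erefl.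
rewrite (Qfun_split _ _ _ _ _ t0 DE).
have [K0|/ltW K0] := leP 0 (1 - 10 * k.+1%:R * (1 + t) * delta).
  by apply: le_trans (ler_wpM2l pA0 bnd); rewrite mulrA; apply: ler_wpM2r.
apply: (@le_trans _ _ 0); first by apply: mulr_ge0_le0 => //; exact: fine_ge0.
apply: mulr_ge0 => //; apply: divr_ge0; last by apply: exprn_ge0; exact: ltW.
by apply: addr_ge0; apply: exprn_ge0.
Qed.

(** * Combining the two split counts through the randomisation *)

Theorem theorem4 (R : realType) (alpha t Delta : R) (B : nat)
  (d : measure_display) (T : measurableType d) (P : probability T R)
  (d' : measure_display) (T' : measurableType d') (PW : probability T' R)
  (U : T -> R) (th : nat -> nat -> T -> R) (theta0 r delta : R) (W : T' -> R) :
  0 < alpha < 1 -> 0 <= t -> 0 <= Delta <= 2^-1 -> (0 < t \/ Delta < 2^-1) ->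
  is_B_alpha alpha t Delta B ->
  (* U ~ Unif[0,1] *)
  measurable_fun setT U ->
  (forall a : R, 0 <= a <= 1 -> P [set w | U w <= a] = a%:E) ->
  (* for k in {B-1, B}: estimators th k 0, ..., th k (k-1), continuously
     distributed, independent of each other and of U *)
  (forall k j, measurable_fun setT (th k j)) ->
  (forall k j, (k = B \/ k = B.-1) -> (j < k)%N -> continuous_rv P (th k j)) ->
  (forall k, (k = B \/ k = B.-1) ->
     mutually_independent P k.+1
       (fun i => if i is i'.+1 then th k i' else U)) ->
  (* the limiting random variable W *)
  measurable_fun setT W -> continuous_rv PW W -> unimodal_at0 PW W ->
  Delta = `|2^-1 - distr_fun PW W 0| ->
  0 < r -> 0 <= delta ->
  (forall k j, (k = B \/ k = B.-1) -> (j < k)%N ->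
     forall u : R,
       `|distr_fun P (fun w => r * (th k j w - theta0)) u - distr_fun PW W u| <= delta) ->
  (P [set w | ~ in_CI t theta0 (fun k j => th k j w)
                 (if (U w <= eta_alpha alpha t Delta B)%R then B else B.-1)]
  <= hulc_bound alpha t delta B)%E.
Proof.
move=> /andP[alpha0 alpha1] t0 _ _ [B1 [QB minB]] mU Uunif mth cth ind mW cW uW DE r0 d0 near.
have t1 : 0 < 1 + t by lra.
(* As [alpha < 1], this excludes [B = 1], so [B.-1] splits still provide at least one estimator. *)
have Q1 : Qfun 1 t Delta = 1.
  by rewrite (Qfun_split _ _ _ _ _ t0 DE) !expr1 expr0 divr1 subrK.
case: B B1 QB minB cth ind near => [//|[|k]] _ QB minB cth ind near.
  by rewrite Q1 leNgt alpha1 in QB.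
rewrite /= in cth ind near *.
set B := k.+2 in QB minB cth ind near *.
(* Minimality of [B] puts [alpha] between the values of [Qfun] at [B] and at [B.-1], which makes
   [eta] a probability. *)
have QB1 : alpha < Qfun k.+1 t Delta.
  by rewrite ltNge; apply/negP => /(minB k.+1 isT); rewrite ltnn.
set eta := eta_alpha alpha t Delta B.
have QQ : 0 < Qfun k.+1 t Delta - Qfun B t Delta by lra.
have eta01 : 0 <= eta <= 1.
  apply/andP; split; first by rewrite /eta /eta_alpha /=; apply: divr_ge0; lra.
  by rewrite /eta /eta_alpha /= ler_pdivrMr // mul1r; lra.
have etaE : eta * Qfun B t Delta + (1 - eta) * Qfun k.+1 t Delta = alpha.
  by rewrite /eta /eta_alpha /=; field; rewrite gt_eqF.
have PA1 : fine (P (U @^-1` [set u | u <= eta])) = eta by rewrite (Uunif _ eta01).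
have PA2 : fine (P (U @^-1` [set u | eta < u])) = 1 - eta.
  rewrite (_ : U @^-1` _ = [set w | eta < U w]) //.
  by rewrite fine_probability_gt // /distr_fun (Uunif _ eta01).
have mA2 : measurable [set u : R | eta < u] by exact: measurable_gt_ray.
have mA1 : measurable [set u : R | u <= eta].
  exact: (measurable_le_event _ _ _ id (@measurable_id _ _ _)).
set E1 := U @^-1` [set u | u <= eta] `&` [set w | ~ in_CI t theta0 (fun k j => th k j w) B].
set E2 := U @^-1` [set u | eta < u] `&` [set w | ~ in_CI t theta0 (fun k j => th k j w) k.+1].
pose C := 10 * B%:R * (1 + t).
have bnd dl : 0 < dl -> delta <= dl -> [/\ measurable E1, measurable E2 &
    (fine (P E1) + fine (P E2)) * (1 - C * dl) <= alpha].
  move=> dl0 ddl.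
  have near' j' j u : (j' = B \/ j' = k.+1) -> (j < j')%N ->
      `|distr_fun P (fun w => r * (th j' j w - theta0)) u - distr_fun PW W u| <= dl.
    by move=> hj' jj; apply: le_trans (near j' j hj' jj u) ddl.
  have [m1 b1] := miscoverage_le R t Delta k.+1 _ _ P _ _ PW U th theta0 r dl W _ t0 mU
    (mth _) (fun i => cth _ i (or_introl erefl)) (ind _ (or_introl erefl)) mW cW uW DE r0 dl0
    (fun j jk u => near' _ j u (or_introl erefl) jk) mA1.
  have [m2 b2] := miscoverage_le R t Delta k _ _ P _ _ PW U th theta0 r dl W _ t0 mU
    (mth _) (fun i => cth _ i (or_intror erefl)) (ind _ (or_intror erefl)) mW cW uW DE r0 dl0
    (fun j jk u => near' _ j u (or_intror erefl) jk) mA2.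
  split=> //; rewrite mulrDl -etaE; rewrite PA1 in b1; rewrite PA2 in b2.
  apply: lerD; first exact: b1.
  (* The factor obtained for [k.+1] splits is weakened to the one for [B], so that both events share
     it. *)
  apply: le_trans b2; apply: ler_wpM2l; first exact: fine_ge0.
  rewrite lerD2l lerN2 /C; do 2! (apply: ler_wpM2r; first by lra).
  by rewrite ler_pM2l // ler_nat.
(* Only measurability is extracted here; [delta + 1] is just some positive admissible value. *)
have [mE1 mE2 _] := bnd (delta + 1) ltac:(lra) ltac:(lra).
set e := fine (P E1) + fine (P E2) in bnd.
have e0 : 0 <= e by rewrite addr_ge0 ?fine_ge0.
have C0 : 0 <= C by rewrite /C !mulr_ge0 // ltW.
(* [miscoverage_le] needs [0 < delta]; the case [delta = 0] is a limit. *)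
have eC : e * (1 - C * delta) <= alpha.
  apply/ler_addgt0Pr => eps eps0.
  (* Raising [delta] by [eps / (e * C + 1)] costs at most [eps]; the [+ 1] covers the case
     [e * C = 0]. *)
  have D0 : 0 < e * C + 1 by rewrite ltr_wpDl // mulr_ge0.
  have x0 : 0 < eps / (e * C + 1) by rewrite divr_gt0.
  have [_ _] := bnd (delta + eps / (e * C + 1)) ltac:(lra) ltac:(lra).
  have : e * C * (eps / (e * C + 1)) <= eps.
    rewrite mulrA ler_pdivrMr // [leRHS]mulrC; apply: ler_wpM2r; lra.
  by move: (eps / _) => z; lra.
rewrite /hulc_bound -/C; set K := 1 - C * delta.
case: ifP => K0; last exact: leey.
have {}K0 : 0 < K by move: K0; rewrite lt_max ltxx.
rewrite max_r; last exact: ltW.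
set E := (X in P X).
have EE : E = E1 `|` E2.
  apply/seteqP; split=> w /=; rewrite /E /=.
    by case: ifP => Uw miss; [left|right]; split => //=; rewrite ltNge Uw.
  by case=> -[/= Uw miss]; [rewrite Uw | rewrite leNgt Uw].
have mE : measurable E by rewrite EE; exact: measurableU.
rewrite -[P E]fineK ?fin_num_measure // lee_fin ler_pdivlMr //.
apply: le_trans eC; apply: ler_wpM2r; first exact: ltW.
rewrite EE /e -fineD ?fin_num_measure // fine_le ?fin_numD ?fin_num_measure ?measureU2 //.
exact: measurableU.
Qed.
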